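(* Suppose the regularity conditions (R), the terminal conditions (T), the simplifying condition (E) and incremental (Lyapunov) stability (LS) stated in the context hold. Then, for any constant $\bar{V}>0$, there exists a constant $\lambda_{\bar{V}}>0$ such that for any $\lambda>\lambda_{\bar{V}}$ and any $x_0\in\mathbb{X}_{\mathrm{ROA}}:=\{x\in\mathbb{R}^n\mid V_{\mathrm{slack}}(x)\le\bar{V}\}$, the origin is exponentially stable for the closed-loop system $x(k+1)=f(x(k),\pi_{\mathrm{slack}}(x(k)))+w(k)$, $x(0)=x_0$, with $w(k)=0$ for all $k\in\mathbb{I}_{\ge0}$.
   Context: Notation. $\|\cdot\|$ is the Euclidean norm; for a positive definite matrix $P$, $\|x\|_P=\sqrt{x^\top Px}$. $\mathbb{I}_{[a,b]}$ (resp. $\mathbb{I}_{\ge a}$) is the set of integers in $[a,b]$ (resp. $\ge a$). $\mathcal{K}_\infty$: continuous, strictly increasing, radially unbounded functions $\alpha:\mathbb{R}_{\ge0}\to\mathbb{R}_{\ge0}$ with $\alpha(0)=0$. System. $x(k+1)=f(x(k),u(k))+w(k)$, $x(0)=x_0\in\mathbb{R}^n$, with inputs $u(k)\in\mathbb{U}\subseteq\mathbb{R}^m$. $\ell:\mathbb{R}^n\times\mathbb{U}\to\mathbb{R}_{\ge0}$ is a stage cost and $\mathbb{X}\subseteq\mathbb{R}^n$ is a closed state constraint set. (R) Regularity: there is $\alpha_\ell\in\mathcal{K}_\infty$ with $\ell(x,u)\ge\alpha_\ell(\|x\|+\|u\|)$ for all $(x,u)\in\mathbb{R}^n\times\mathbb{U}$;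 $f(0,0)=0$, $\ell(0,0)=0$, $0\in\mathrm{int}(\mathbb{U})$, $0\in\mathrm{int}(\mathbb{X})$; $f,\ell$ are continuous; $\mathbb{U}$ is compact. Nominal MPC. Fix $N\in\mathbb{I}_{\ge1}$. For $x\in\mathbb{R}^n$ and $\mathbf{u}=(\mathbf{u}_0,\dots,\mathbf{u}_{N-1})\in\mathbb{U}^N$, $x_{\mathbf{u}}(k,x)$ is the state after $k$ steps of the undisturbed system ($w\equiv0$) started at $x_{\mathbf{u}}(0,x)=x$. Let $V_{\mathrm{f}}:\mathbb{R}^n\to\mathbb{R}_{\ge0}$ be continuous, $\mathbb{X}_{\mathrm{f}}\subseteq\mathbb{X}$ closed, and $$\mathcal{J}_N(x,\mathbf{u})=\sum_{k=0}^{N-1}\ell(x_{\mathbf{u}}(k,x),\mathbf{u}_k)+V_{\mathrm{f}}(x_{\mathbf{u}}(N,x)).$$ $\mathbb{X}_N\subseteq\mathbb{X}$ is the set of $x$ for which there is $\mathbf{u}\in\mathbb{U}^N$ with $x_{\mathbf{u}}(k,x)\in\mathbb{X}$ for $k\in\mathbb{I}_{[0,N-1]}$ and $x_{\mathbf{u}}(N,x)\in\mathbb{X}_{\mathrm{f}}$. (T) Terminal conditions: there are $k_{\mathrm{f}}:\mathbb{X}_{\mathrm{f}}\to\mathbb{U}$ and $\alpha_{\mathrm{f}}\in\mathcal{K}_\infty$ such that for every $x\in\mathbb{X}_{\mathrm{f}}$, with $u=k_{\mathrm{f}}(x)$, $x^+=f(x,u)$: $V_{\mathrm{f}}(x^+)\le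 V_{\mathrm{f}}(x)-\ell(x,u)$; $(x,u)\in\mathbb{X}\times\mathbb{U}$; $x^+\in\mathbb{X}_{\mathrm{f}}$; $V_{\mathrm{f}}(x)\le\alpha_{\mathrm{f}}(\|x\|)$. Moreover $0\in\mathrm{int}(\mathbb{X}_{\mathrm{f}})$ and $\mathbb{X}_N$ is compact. (E) Simplifying condition: $\alpha_\ell(r)=c_\ell r^2$ and $\alpha_{\mathrm{f}}(r)=c_{\mathrm{f}}r^2$ are quadratic. (LS) Incremental stability: $V_\delta(x,z)=\|x-z\|_P^2$ with $P$ positive definite, and $V_\delta(f(x,u),f(z,u))\le V_\delta(x,z)$ for all $x,z\in\mathbb{R}^n$, $u\in\mathbb{U}$. Relaxed MPC. For a weight $\lambda>0$, $$V_{\mathrm{slack}}(x)=\min_{\bar{x}\in\mathbb{R}^n,\,\mathbf{u}\in\mathbb{U}^N}\mathcal{J}_N(\bar{x},\mathbf{u})+\lambda V_\delta(x,\bar{x})\quad\text{s.t. }x_{\mathbf{u}}(k,\bar{x})\in\mathbb{X},\ k\in\mathbb{I}_{[0,N-1]},\ x_{\mathbf{u}}(N,\bar{x})\in\mathbb{X}_{\mathrm{f}},$$ with minimizer denoted $(\bar{x}^*_{\mathrm{slack}}(x),\mathbf{u}^*_{\mathrm{slack}}(x))$, and $\pi_{\mathrm{slack}}(x)=\mathbf{u}^*_{\mathrm{slack},0}(x)\in\mathbb{U}$ is its first input. Both $V_{\mathrm{slack}}$ and $\pi_{\mathrm{slack}}$ (hence $\mathbb{X}_{\mathrm{ROA}}$)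 depend on $\lambda$. *)

(* Defs.v *)
From HB Require Import structures.
From mathcomp Require Import all_boot all_order all_algebra.
From mathcomp Require Import all_classical all_reals all_analysis.

Set Implicit Arguments.
Unset Strict Implicit.
Unset Printing Implicit Defensive.

Import Order.TTheory GRing.Theory Num.Theory.
Import numFieldNormedType.Exports.

Local Open Scope classical_set_scope.
Local Open Scope ring_scope.

(* The library norm `|x| on matrices is the max norm, hence this definition. *)
Definition enorm (R : realType) (n : nat) (x : 'cV[R]_n) : R :=
  Num.sqrt (\sum_(i < n) x i 0 ^+ 2).

Definition posdef (R : realType) (n : nat) (P : 'M[R]_n) : Prop :=
  P^T = P /\ forall x : 'cV[R]_n, x != 0 -> 0 < (x^T *m P *m x) 0 0.

Definition wnorm (R : realType) (n : nat) (P : 'M[R]_n) (x : 'cV[R]_n) : R :=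
  Num.sqrt ((x^T *m P *m x) 0 0).

(* A function on R_{>=0} is represented by a total function R -> R of which
   only the values on [0, +oo[ matter. *)
Definition class_Kinf (R : realType) (alpha : R -> R) : Prop :=
  [/\ {within [set r : R | 0 <= r], continuous alpha},
      forall r s : R, 0 <= r -> r < s -> alpha r < alpha s,
      alpha 0 = 0
    & alpha r @[r --> +oo] --> +oo].

(* Functions whose natural domain is R^n x U (the dynamics, the stage cost) are
   total; nothing is assumed of their values at inputs outside [inputs]. *)
Record mpc_data (R : realType) (n m : nat) := MpcData {
  dyn : 'cV[R]_n -> 'cV[R]_m -> 'cV[R]_n;
  stage_cost : 'cV[R]_n -> 'cV[R]_m -> R;
  inputs : set 'cV[R]_m;
  states : set 'cV[R]_n;
  term_cost : 'cV[R]_n -> R;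
  term_set : set 'cV[R]_n }.

Record well_posed (R : realType) (n m : nat) (D : mpc_data R n m) : Prop :=
  WellPosed {
    stage_cost_ge0 : forall x u, inputs D u -> 0 <= stage_cost D x u;
    states_closed : closed (states D);
    term_cost_ge0 : forall x, 0 <= term_cost D x;
    term_cost_continuous : continuous (term_cost D);
    term_set_closed : closed (term_set D);
    term_set_sub : term_set D `<=` states D }.

Record regular (R : realType) (n m : nat) (D : mpc_data R n m)
    (alpha_l : R -> R) : Prop := Regular {
  regular_Kinf : class_Kinf alpha_l;
  regular_lower : forall x u, inputs D u ->
    alpha_l (enorm x + enorm u) <= stage_cost D x u;
  regular_dyn0 : dyn D 0 0 = 0;
  regular_cost0 : stage_cost D 0 0 = 0;
  regular_inputs0 : interior (inputs D) 0;
  regular_states0 : interior (states D) 0;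
  regular_dyn_continuous :
    {within [set p : 'cV[R]_n * 'cV[R]_m | inputs D p.2],
      continuous (fun p => dyn D p.1 p.2)};
  regular_cost_continuous :
    {within [set p : 'cV[R]_n * 'cV[R]_m | inputs D p.2],
      continuous (fun p => stage_cost D p.1 p.2)};
  regular_inputs_compact : compact (inputs D) }.

(* Nominal state after k <= N steps from x. *)
Definition traj (R : realType) (n m : nat) (D : mpc_data R n m) (N : nat)
    (u : N.-tuple 'cV[R]_m) (k : nat) (x : 'cV[R]_n) : 'cV[R]_n :=
  foldl (dyn D) x (take k u).

Definition J_cost (R : realType) (n m : nat) (D : mpc_data R n m) (N : nat)
    (x : 'cV[R]_n) (u : N.-tuple 'cV[R]_m) : R :=
  \sum_(k < N) stage_cost D (traj D u k x) u`_k + term_cost D (traj D u N x).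

Definition admissible (R : realType) (n m : nat) (D : mpc_data R n m) (N : nat)
    (x : 'cV[R]_n) (u : N.-tuple 'cV[R]_m) : Prop :=
  [/\ forall k, (k < N)%N -> inputs D u`_k,
      forall k, (k < N)%N -> states D (traj D u k x)
    & term_set D (traj D u N x)].

Definition feasible_set (R : realType) (n m : nat) (D : mpc_data R n m)
    (N : nat) : set 'cV[R]_n :=
  [set x | exists u : N.-tuple 'cV[R]_m, admissible D x u].

Record terminal (R : realType) (n m : nat) (D : mpc_data R n m) (N : nat)
    (alpha_f : R -> R) : Prop := Terminal {
  terminal_Kinf : class_Kinf alpha_f;
  terminal_law : exists k_f : 'cV[R]_n -> 'cV[R]_m,
    forall x, term_set D x ->
      [/\ term_cost D (dyn D x (k_f x)) <=
            term_cost D x - stage_cost D x (k_f x),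
          states D x /\ inputs D (k_f x),
          term_set D (dyn D x (k_f x))
        & term_cost D x <= alpha_f (enorm x)];
  terminal_set0 : interior (term_set D) 0;
  terminal_compact : compact (feasible_set D N) }.

Definition quadratic (R : realType) (alpha : R -> R) : Prop :=
  exists c : R, forall r, 0 <= r -> alpha r = c * r ^+ 2.

Definition V_delta (R : realType) (n : nat) (P : 'M[R]_n)
    (x z : 'cV[R]_n) : R := wnorm P (x - z) ^+ 2.

Definition incr_stable (R : realType) (n m : nat) (D : mpc_data R n m)
    (P : 'M[R]_n) : Prop :=
  posdef P /\
  forall x z u, inputs D u ->
    V_delta P (dyn D x u) (dyn D z u) <= V_delta P x z.

Definition slack_objective (R : realType) (n m : nat) (D : mpc_data R n m)
    (N : nat) (P : 'M[R]_n) (lambda : R) (x xbar : 'cV[R]_n)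
    (u : N.-tuple 'cV[R]_m) : R :=
  J_cost D xbar u + lambda * V_delta P x xbar.

(* Extended-real infimum, so that no junk value arises; it is the minimum
   whenever a minimizer exists. *)
Definition V_slack (R : realType) (n m : nat) (D : mpc_data R n m)
    (N : nat) (P : 'M[R]_n) (lambda : R) (x : 'cV[R]_n) : \bar R :=
  ereal_inf [set (slack_objective D P lambda x p.1 p.2)%:E |
    p in [set p : 'cV[R]_n * N.-tuple 'cV[R]_m | admissible D p.1 p.2]].

Definition slack_minimizer (R : realType) (n m : nat) (D : mpc_data R n m)
    (N : nat) (P : 'M[R]_n) (lambda : R) (x xbar : 'cV[R]_n)
    (u : N.-tuple 'cV[R]_m) : Prop :=
  admissible D xbar u /\
  forall (y : 'cV[R]_n) (v : N.-tuple 'cV[R]_m), admissible D y v ->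
    slack_objective D P lambda x xbar u <= slack_objective D P lambda x y v.

(* [s] picks a minimizer at every state at which there is one: the existence of
   minimizers is not assumed, and ties are broken arbitrarily. *)
Definition slack_selection (R : realType) (n m : nat) (D : mpc_data R n m)
    (N : nat) (P : 'M[R]_n) (lambda : R)
    (s : 'cV[R]_n -> 'cV[R]_n * N.-tuple 'cV[R]_m) : Prop :=
  forall x, (exists xbar (u : N.-tuple 'cV[R]_m),
               slack_minimizer D P lambda x xbar u) ->
    slack_minimizer D P lambda x (s x).1 (s x).2.

Definition pi_slack (R : realType) (n m N : nat)
    (s : 'cV[R]_n -> 'cV[R]_n * N.-tuple 'cV[R]_m) (x : 'cV[R]_n) : 'cV[R]_m :=
  ((s x).2)`_0.

Definition X_ROA (R : realType) (n m : nat) (D : mpc_data R n m)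
    (N : nat) (P : 'M[R]_n) (lambda Vbar : R) : set 'cV[R]_n :=
  [set x | (V_slack D N P lambda x <= Vbar%:E)%E].

Definition closed_loop (R : realType) (n m : nat) (D : mpc_data R n m)
    (pi : 'cV[R]_n -> 'cV[R]_m) (w : nat -> 'cV[R]_n) (x0 : 'cV[R]_n)
    (x : nat -> 'cV[R]_n) : Prop :=
  x 0%N = x0 /\ forall k, x k.+1 = dyn D (x k) (pi (x k)) + w k.

(* Exponential stability of the origin with region of attraction S: the
   constants are uniform over the initial states in S. *)
Definition exp_stable (R : realType) (n m : nat) (D : mpc_data R n m)
    (pi : 'cV[R]_n -> 'cV[R]_m) (w : nat -> 'cV[R]_n)
    (S : set 'cV[R]_n) : Prop :=
  exists C rho : R, [/\ 0 < C, 0 < rho, rho < 1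
    & forall x0 x, S x0 -> closed_loop D pi w x0 x ->
        forall k, enorm (x k) <= C * rho ^+ k * enorm x0].

(* Main.v *)
Require Import Defs.
From mathcomp Require Import all_boot all_order all_algebra.
From mathcomp Require Import all_classical all_reals all_analysis.
From mathcomp Require Import ring lra.
Import Order.TTheory GRing.Theory Num.Theory.
Import numFieldNormedType.Exports.
Local Open Scope classical_set_scope.
Local Open Scope ring_scope.

(** The optimal value W of the relaxed problem is a quadratic Lyapunov function
    for the closed loop.  Write (y, u) for the minimizer at the state x.

    - Minimizers exist as soon as some pair is admissible
      ([slack_minimizer_exists]): the admissible pairs form a compact set and
      the objective is continuous on it.
    - Decrease ([slack_value_decrease]): at the next state, the next nominal
      state together with the shifted inputs is a candidate.  Its nominal cost
      is smaller by the stage cost l(y, u_0), and incremental stability says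
      that the penalty, the weighted distance of the true and the nominal
      state, does not increase.  So W decreases by at least
      l(y, u_0) >= c_l |y|^2, and its sublevel set is invariant.
    - Upper bound ([slack_value_quadratic]): on the sublevel set of Vbar, W is
      at most c |x|^2, with c independent of lambda.
    - Comparison of y and x ([slack_minimizer_state_ge]): the penalty is part of
      W, so lambda |x - y|_P^2 <= c |x|^2, and once lambda exceeds 4 kappa c,
      where |z|^2 <= kappa |z|_P^2, this forces |x| <= 2 |y|.

    Hence (c_l / 4) |x|^2 <= W(x) <= c |x|^2 and W decreases by at least
    (c_l / 4) |x|^2 at each step, which gives exponential decay
    ([exponential_decay]). *)

Set Implicit Arguments.
Unset Strict Implicit.
Unset Printing Implicit Defensive.

(** * Norms and class-K functions *)

Lemma posdef_ge0 (R : realType) (n : nat) (P : 'M[R]_n) (x : 'cV[R]_n) :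
  posdef P -> 0 <= (x^T *m P *m x) 0 0.
Proof.
case=> _ posP; have [->|/posP/ltW //] := eqVneq x 0.
by rewrite mulmx0 mxE.
Qed.

Lemma wnorm_sqr (R : realType) (n : nat) (P : 'M[R]_n) (x : 'cV[R]_n) :
  posdef P -> wnorm P x ^+ 2 = (x^T *m P *m x) 0 0.
Proof. by move=> posP; rewrite sqr_sqrtr // posdef_ge0. Qed.

(** Expanding the nonnegative number q(c x - b y), where q is the quadratic
    form of P, b its bilinear form at (x, y) and c = q(y), gives
    c (q(x) q(y) - b^2). *)
Lemma posdef_Cauchy_Schwarz (R : realType) (n : nat) (P : 'M[R]_n)
    (x y : 'cV[R]_n) : posdef P ->
  ((x^T *m P *m y) 0 0) ^+ 2 <= (x^T *m P *m x) 0 0 * (y^T *m P *m y) 0 0.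
Proof.
move=> posP; have [->|y0] := eqVneq y 0.
  by rewrite !mulmx0 !mxE expr0n mulr0.
set b := (x^T *m P *m y) 0 0; set c := (y^T *m P *m y) 0 0.
have c_gt0 : 0 < c by exact: posP.2.
have yx : (y^T *m P *m x) 0 0 = b.
  have -> : y^T *m P *m x = (x^T *m P *m y)^T.
    by rewrite !trmx_mul trmxK posP.1 mulmxA.
  by rewrite [LHS]mxE.
have := posdef_ge0 (c *: x - b *: y) posP.
have -> : (c *: x - b *: y)^T = c *: x^T - b *: y^T.
  by rewrite linearB !linearZ.
rewrite mulmxBl mulmxBl -!scalemxAl mulmxBr mulmxBr -!scalemxAr.
have entryB (A B : 'M[R]_1) : (A - B) 0 0 = A 0 0 - B 0 0 by rewrite !mxE.
have entryZ t (A : 'M[R]_1) : (t *: A) 0 0 = t * A 0 0 by rewrite mxE.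
rewrite !(entryB, entryZ) yx -/b -/c.
set a := (x^T *m P *m x) 0 0.
rewrite [X in 0 <= X](_ : _ = c * (a * c - b ^+ 2)); last by ring.
by rewrite pmulr_rge0 // subr_ge0.
Qed.

Lemma posdef_unitmx (R : realType) (n : nat) (P : 'M[R]_n) :
  posdef P -> P \in unitmx.
Proof.
case=> _ posP; rewrite -row_free_unit -kermx_eq0; apply/eqP/eqP/rowV0P => v.
move/sub_kermxP => vP; apply: trmx_inj; rewrite trmx0; apply/eqP.
apply/negPn/negP => /posP; rewrite trmxK vP mul0mx mxE ltxx //.
Qed.

Lemma enorm_sqr (R : realType) (n : nat) (x : 'cV[R]_n) :
  enorm x ^+ 2 = \sum_(i < n) x i 0 ^+ 2.
Proof. by rewrite sqr_sqrtr // sumr_ge0 // => i _; rewrite sqr_ge0. Qed.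

Lemma enorm_ge0 (R : realType) (n : nat) (x : 'cV[R]_n) : 0 <= enorm x.
Proof. exact: sqrtr_ge0. Qed.

(** With y_i = P^-1 e_i, the coordinate x_i is the P-inner product of x and
    y_i, so Cauchy-Schwarz bounds x_i^2 by |y_i|_P^2 |x|_P^2.  This replaces the
    least eigenvalue of P by an explicit constant. *)
Lemma enorm_sqr_le_wnorm (R : realType) (n : nat) (P : 'M[R]_n) :
  posdef P ->
  exists2 kappa : R, 0 < kappa &
    forall x : 'cV[R]_n, enorm x ^+ 2 <= kappa * wnorm P x ^+ 2.
Proof.
move=> posP; pose y i : 'cV[R]_n := invmx P *m delta_mx i 0.
pose s := \sum_i ((y i)^T *m P *m y i) 0 0.
have s_ge0 : 0 <= s by apply: sumr_ge0 => i _; exact: posdef_ge0.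
exists (1 + s); first by rewrite ltr_wpDr.
move=> x; rewrite wnorm_sqr // enorm_sqr.
apply: (@le_trans _ _ (s * (x^T *m P *m x) 0 0)); last first.
  by rewrite ler_wpM2r ?posdef_ge0 // lerDr.
rewrite mulr_suml; apply: ler_sum => i _.
have xi : x i 0 = (x^T *m P *m y i) 0 0.
  rewrite /y mulmxA mulmxK ?posdef_unitmx // -colE !mxE //.
by rewrite xi mulrC posdef_Cauchy_Schwarz.
Qed.

Lemma enorm_sqrD_le (R : realType) (n : nat) (x y : 'cV[R]_n) :
  enorm x ^+ 2 <= 2 * enorm y ^+ 2 + 2 * enorm (x - y) ^+ 2.
Proof.
rewrite !enorm_sqr !mulr_sumr -big_split; apply: ler_sum => i _ /=.
(* The gap between the two sides is (x_i - 2 y_i)^2. *)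
rewrite !mxE; have := sqr_ge0 (x i 0 - 2 * y i 0); lra.
Qed.

Lemma nbhs0_enorm (R : realType) (n : nat) (A : set 'cV[R]_n) :
  nbhs (0 : 'cV[R]_n) A ->
  exists2 eps : R, 0 < eps & forall x, enorm x < eps -> A x.
Proof.
move=> /nbhs_ballP[eps eps0 sA]; exists eps => // x xeps; apply: sA.
split=> // i j; rewrite (ord1 j) -ball_normE /= mxE sub0r normrN.
apply: le_lt_trans xeps; rewrite -sqrtr_sqr ler_wsqrtr //.
by rewrite (bigD1 i) //= lerDl sumr_ge0 // => k _; rewrite sqr_ge0.
Qed.

Lemma quadratic_Kinf (R : realType) (alpha : R -> R) :
  class_Kinf alpha -> quadratic alpha ->
  exists2 c : R, 0 < c & forall r, 0 <= r -> alpha r = c * r ^+ 2.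
Proof.
case=> _ incr a0 _ [c alphaE]; exists c => //.
have := incr 0 1 (lexx _) ltr01.
by rewrite a0 alphaE // expr1n mulr1.
Qed.

(** * Existence of minimizers *)

Lemma traj0 (R : realType) (n m N : nat) (D : mpc_data R n m)
    (u : N.-tuple 'cV[R]_m) (x : 'cV[R]_n) : traj D u 0 x = x.
Proof. by rewrite /traj take0. Qed.

Lemma trajS (R : realType) (n m N : nat) (D : mpc_data R n m)
    (u : N.-tuple 'cV[R]_m) (k : nat) (x : 'cV[R]_n) : (k < N)%N ->
  traj D u k.+1 x = dyn D (traj D u k x) u`_k.
Proof.
by move=> kN; rewrite /traj (take_nth 0) ?size_tuple // -cats1 foldl_cat.
Qed.

(** Composition of limits when the outer function is continuous only
    relatively to A: the inner one has to stay in A. *)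
Lemma cvg_within_comp (S T U : topologicalType) (F : set_system S)
    (A : set T) (h : S -> T) (g : T -> U) (y : T) :
  Filter F -> {within A, continuous g} -> A y ->
  (\forall p \near F, A (h p)) -> h @ F --> y -> g (h p) @[p --> F] --> g y.
Proof.
move=> FF /subspace_continuousP/(_ y) + Ay hA hy => /(_ Ay) gy.
by apply: cvg_trans gy => B /= /hy hB; apply: filterS2 hA hB => p Ap; apply.
Qed.

Lemma cvg_sum_real (R : realType) (I T : Type) (F : set_system T) (r : seq I)
    (f : I -> T -> R) (l : I -> R) :
  Filter F -> (forall i, f i x @[x --> F] --> l i) ->
  \sum_(i <- r) f i x @[x --> F] --> \sum_(i <- r) l i.
Proof. by move=> FF fl; apply: cvg_big => //; exact: add_continuous. Qed.

Lemma continuous_qform (R : realType) (n : nat) (P : 'M[R]_n) :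
  continuous (fun x : 'cV[R]_n => (x^T *m P *m x) 0 0).
Proof.
have -> : (fun x : 'cV[R]_n => (x^T *m P *m x) 0 0) =
          (fun x => \sum_j \sum_i x i 0 * P i j * x j 0).
  apply/funext => x; rewrite mxE; apply: eq_bigr => j _.
  rewrite mxE mulr_suml; apply: eq_bigr => i _; by rewrite mxE.
move=> x; apply: cvg_sum_real => [|j]; first exact: nbhs_filter.
apply: cvg_sum_real => [|i]; first exact: nbhs_filter.
have cx k : (y : 'cV[R]_n) k 0 @[y --> x] --> x k 0 by exact: coord_continuous.
exact: (cvgM (cvgM (cx i) (cvg_cst (P i j))) (cx j)).
Qed.

(** Input sequences as functions with the product topology, to which Tychonoff
    applies. *)
Definition input_space (R : realType) (m N : nat) :=
  prod_topology (fun _ : 'I_N => 'cV[R]_m).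

Definition tuple_of_inputs (R : realType) (m N : nat)
    (v : input_space R m N) : N.-tuple 'cV[R]_m := [tuple v i | i < N].

Lemma nth_tuple_of_inputs (R : realType) (m N : nat) (v : input_space R m N)
    (i : 'I_N) : (tuple_of_inputs v)`_i = v i.
Proof. by rewrite -tnth_nth tnth_mktuple. Qed.

Lemma tuple_of_inputs_tnth (R : realType) (m N : nat)
    (u : N.-tuple 'cV[R]_m) : tuple_of_inputs (tnth u) = u.
Proof. by apply: eq_from_tnth => i; rewrite tnth_mktuple. Qed.

Definition input_pairs (R : realType) (n m N : nat) (D : mpc_data R n m) :
    set ('cV[R]_n * input_space R m N) :=
  [set p | forall i, inputs D (p.2 i)].

Lemma continuous_input (R : realType) (n m N : nat) (i : 'I_N) :
  continuous (fun p : 'cV[R]_n * input_space R m N => p.2 i).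
Proof.
move=> p.
have cvg2 : q.2 @[q --> p] --> p.2 by exact: (@cvg_snd _ _ (nbhs p.1)).
exact: (cvg_comp _ _ cvg2 (@proj_continuous 'I_N (fun _ => 'cV[R]_m) i p.2)).
Qed.

Lemma continuous_along_traj (R : realType) (n m N : nat) (D : mpc_data R n m)
    (T : topologicalType) (g : 'cV[R]_n -> 'cV[R]_m -> T)
    (h : 'cV[R]_n * input_space R m N -> 'cV[R]_n) (i : 'I_N) :
  {within [set p : 'cV[R]_n * 'cV[R]_m | inputs D p.2],
    continuous (fun p => g p.1 p.2)} ->
  {within input_pairs D, continuous h} ->
  {within input_pairs D, continuous (fun p => g (h p) (p.2 i))}.
Proof.
move=> cg /subspace_continuousP ch; apply/subspace_continuousP => p pA.
apply: (@cvg_within_comp _ _ _ (within (input_pairs D) (nbhs p)) _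
  (fun q => (h q, q.2 i)) _ (h p, p.2 i) _ cg).
- exact: pA.
- by rewrite near_withinE; apply: nearW => q qA; exact: qA.
- have cpi : q.2 i @[q --> within (input_pairs D) (nbhs p)] --> p.2 i.
    by apply: cvg_within_filter; exact: continuous_input.
  exact: (cvg_pair (ch _ pA) cpi).
Qed.

(** Continuity is relative to [input_pairs]: the dynamics is arbitrary at
    inputs outside the input set. *)
Lemma continuous_traj (R : realType) (n m N : nat) (D : mpc_data R n m)
    (k : nat) :
  {within [set p : 'cV[R]_n * 'cV[R]_m | inputs D p.2],
    continuous (fun p => dyn D p.1 p.2)} ->
  (k <= N)%N ->
  {within input_pairs (N := N) D,
    continuous (fun p => traj D (tuple_of_inputs p.2) k p.1)}.
Proof.
move=> cD; elim: k => [_|k IH kN].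
  have -> : (fun p : 'cV[R]_n * input_space R m N =>
      traj D (tuple_of_inputs p.2) 0 p.1) = fst.
    by apply/funext => p; rewrite /traj take0.
  by apply: continuous_subspaceT => p; exact: (@cvg_fst _ _ _ (nbhs p.2)).
have -> : (fun p : 'cV[R]_n * input_space R m N =>
    traj D (tuple_of_inputs p.2) k.+1 p.1) =
    (fun p => dyn D (traj D (tuple_of_inputs p.2) k p.1) (p.2 (Ordinal kN))).
  by apply/funext => p; rewrite trajS // (nth_tuple_of_inputs _ (Ordinal kN)).
exact/continuous_along_traj/IH/ltnW.
Qed.

(** An ultrafilter on the admissible pairs lives on the compact product of the
    feasible set and the input sequences, hence converges there; predicted
    states pass to the limit, and the state and terminal sets are closed. *)
Lemma compact_admissible (R : realType) (n m N : nat) (D : mpc_data R n m)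
    (alpha_l : R -> R) :
  well_posed D -> regular D alpha_l -> compact (feasible_set D N) ->
  compact [set p : 'cV[R]_n * input_space R m N |
    admissible D p.1 (tuple_of_inputs p.2)].
Proof.
move=> wD rD cX; rewrite compact_ultra => F FF FA.
have FU : \forall p \near F, input_pairs D p.
  apply: filterS FA => p [inU _ _] i.
  by rewrite -nth_tuple_of_inputs; exact: inU.
have cU : compact [set v : input_space R m N | forall i, inputs D (v i)].
  exact: (tychonoff (fun _ => regular_inputs_compact rD)).
have := compact_setX cX cU; rewrite compact_ultra => /(_ F FF) cF.
have [|p [[_ pU] Fp]] := cF.
  apply: filterS2 FA FU => p pA pU; split => //=.
  by exists (tuple_of_inputs p.2).
(* Relative continuity only sees limits along pairs with inputs in the input
   set. *)
have FpU : F --> within (input_pairs D) (nbhs p).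
  by move=> B /Fp FB; apply: filterS2 FU FB => q qU; exact.
have Ftraj k : (k <= N)%N ->
    traj D (tuple_of_inputs q.2) k q.1 @[q --> F] -->
    traj D (tuple_of_inputs p.2) k p.1.
  move=> kN; apply: cvg_trans (cvg_app _ FpU) _.
  have /subspace_continuousP := continuous_traj (regular_dyn_continuous rD) kN.
  exact.
exists p; split; last exact: Fp.
split => [k kN|k kN|].
- by rewrite (nth_tuple_of_inputs _ (Ordinal kN)); exact: pU.
- apply: (closed_cvg _ (states_closed wD) _ _ (Ftraj k (ltnW kN))).
  by apply: filterS FA => q [_ /(_ k kN)].
- apply: (closed_cvg _ (term_set_closed wD) _ _ (Ftraj N (leqnn N))).
  by apply: filterS FA => q [].
Qed.

Lemma continuous_slack_objective (R : realType) (n m N : nat)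
    (D : mpc_data R n m) (alpha_l : R -> R) (P : 'M[R]_n) (lambda : R)
    (x : 'cV[R]_n) :
  well_posed D -> regular D alpha_l -> posdef P ->
  {within input_pairs (N := N) D, continuous
    (fun p => slack_objective D P lambda x p.1 (tuple_of_inputs p.2))}.
Proof.
move=> wD rD posP; apply/subspace_continuousP => p pU.
have ctraj k (kN : (k <= N)%N) :=
  continuous_traj (regular_dyn_continuous rD) kN.
apply: cvgD; first apply: cvgD.
- apply: cvg_sum_real => i.
  have -> : (fun q : 'cV[R]_n * input_space R m N => stage_cost D
        (traj D (tuple_of_inputs q.2) i q.1) (tuple_of_inputs q.2)`_i) =
      (fun q => stage_cost D (traj D (tuple_of_inputs q.2) i q.1) (q.2 i)).
    by apply/funext => q; rewrite nth_tuple_of_inputs.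
  rewrite nth_tuple_of_inputs.
  have /subspace_continuousP := continuous_along_traj (i := i)
    (regular_cost_continuous rD) (ctraj i (ltnW (ltn_ord i))).
  exact.
- apply: continuous_cvg; first exact: term_cost_continuous.
  by have /subspace_continuousP := ctraj N (leqnn N); exact.
- apply: cvgMr; apply: cvg_within_filter.
  rewrite /V_delta; under eq_cvg do rewrite wnorm_sqr //.
  rewrite wnorm_sqr //.
  apply: (cvg_comp (fun q => x - q.1)
    (fun z : 'cV[R]_n => (z^T *m P *m z) 0 0));
    last exact: continuous_qform.
  apply: cvgB; first exact: cvg_cst.
  exact: (@cvg_fst _ _ _ (nbhs p.2)).
Qed.

Lemma slack_minimizer_exists (R : realType) (n m N : nat)
    (D : mpc_data R n m) (alpha_l : R -> R) (P : 'M[R]_n) (lambda : R)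
    (x y : 'cV[R]_n) (v : N.-tuple 'cV[R]_m) :
  well_posed D -> regular D alpha_l -> compact (feasible_set D N) ->
  posdef P -> admissible D y v ->
  exists xbar (u : N.-tuple 'cV[R]_m), slack_minimizer D P lambda x xbar u.
Proof.
move=> wD rD cX posP yv.
have sub : [set p : 'cV[R]_n * input_space R m N |
    admissible D p.1 (tuple_of_inputs p.2)] `<=` input_pairs D.
  by move=> p [inU _ _] i; rewrite -nth_tuple_of_inputs; exact: inU.
case: (compact_EVT_min _ (compact_admissible wD rD cX)
  (continuous_subspaceW sub
    (continuous_slack_objective (lambda := lambda) (x := x) wD rD posP))).
  by exists (y, tnth v); rewrite /= tuple_of_inputs_tnth.
move=> p; rewrite inE /= => pA pmin.
exists p.1, (tuple_of_inputs p.2); split => // z w zw.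
have := pmin (z, tnth w); rewrite /= tuple_of_inputs_tnth; apply.
by rewrite inE /= tuple_of_inputs_tnth.
Qed.

(** * Terminal law and shifted input sequences *)

(** The part of the terminal conditions that drives the recursion, for a fixed
    terminal law. *)
Definition terminal_feedback (R : realType) (n m : nat) (D : mpc_data R n m)
    (k_f : 'cV[R]_n -> 'cV[R]_m) : Prop :=
  forall x, term_set D x ->
    [/\ term_cost D (dyn D x (k_f x)) <=
          term_cost D x - stage_cost D x (k_f x),
        states D x, inputs D (k_f x) & term_set D (dyn D x (k_f x))].

(** Following the terminal law for N steps keeps the state in the terminal
    set, and the decrease of the terminal cost telescopes. *)
Lemma terminal_rollout (R : realType) (n m N : nat) (D : mpc_data R n m)
    (k_f : 'cV[R]_n -> 'cV[R]_m) (x : 'cV[R]_n) :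
  terminal_feedback D k_f -> term_set D x ->
  exists v : N.-tuple 'cV[R]_m,
    admissible D x v /\ J_cost D x v <= term_cost D x.
Proof.
move=> law xf; pose xi k := iter k (fun y => dyn D y (k_f y)) x.
have xif k : term_set D (xi k) by elim: k => //= k /law[].
pose v := [tuple k_f (xi i) | i < N].
have vE k : (k < N)%N -> v`_k = k_f (xi k).
  by move=> kN; rewrite -(tnth_nth 0 v (Ordinal kN)) tnth_mktuple.
have trajE k : (k <= N)%N -> traj D v k x = xi k.
  elim: k => [_|k IH kN]; first by rewrite traj0.
  by rewrite trajS // IH ?vE // ltnW.
exists v; split.
  split=> [k kN|k kN|]; last by rewrite trajE.
    by rewrite vE //; case: (law _ (xif k)).
  by rewrite trajE 1?ltnW //; case: (law _ (xif k)).
rewrite /J_cost trajE //.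
rewrite (eq_bigr (fun k : 'I_N => stage_cost D (xi k) (k_f (xi k))));
  last first.
  by move=> k _; rewrite trajE ?vE // ltnW.
elim: (N) => [|j IH]; first by rewrite big_ord0 add0r.
rewrite big_ord_recr /=; apply: le_trans IH.
by case: (law _ (xif j)) => + _ _ _; rewrite /= -/(xi j); lra.
Qed.

(** The usual warm start of predictive control: drop the input just applied
    and append one step of the terminal law, whose stage cost is paid for by
    the decrease of the terminal cost. *)
Lemma shifted_inputs (R : realType) (n m N : nat) (D : mpc_data R n m)
    (k_f : 'cV[R]_n -> 'cV[R]_m) (y : 'cV[R]_n) (u : N.-tuple 'cV[R]_m) :
  (0 < N)%N -> terminal_feedback D k_f -> admissible D y u ->
  exists v : N.-tuple 'cV[R]_m, admissible D (dyn D y u`_0) v /\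
    J_cost D (dyn D y u`_0) v <= J_cost D y u - stage_cost D y u`_0.
Proof.
case: N u => // N u _ law [].
case/tupleP: u => u0 t inU inX /=; set z := traj _ _ _ _ => zf.
have [Vf zX kU zf'] := law _ zf.
pose v := [tuple of rcons t (k_f z)]; set y' := dyn D y u0.
have vE k : (k < N)%N -> v`_k = t`_k.
  by move=> kN; rewrite nth_rcons size_tuple kN.
have vN : v`_N = k_f z by rewrite nth_rcons size_tuple ltnn eqxx.
have trajE k : (k <= N)%N -> traj D v k y' = traj D [tuple of u0 :: t] k.+1 y.
  by move=> kN; rewrite /traj /= -cats1 takel_cat // size_tuple.
have zE : traj D v N y' = z by rewrite trajE.
have trajN : traj D v N.+1 y' = dyn D z (k_f z) by rewrite trajS // zE vN.
exists v; split.
  split=> [k|k|]; last by rewrite trajN.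
    rewrite ltnS leq_eqVlt => /orP[/eqP->|kN]; first by rewrite vN.
    by rewrite vE //; exact: (inU k.+1).
  rewrite ltnS leq_eqVlt => /orP[/eqP->|kN]; first by rewrite zE.
  by rewrite trajE 1?ltnW //; exact: inX.
rewrite /J_cost trajN -/z big_ord_recr big_ord_recl /= zE vN.
rewrite traj0.
rewrite (eq_bigr (fun i : 'I_N =>
  stage_cost D (traj D [tuple of u0 :: t] i.+1 y) t`_i)) => [|i _]; last first.
  by rewrite trajE 1?ltnW // vE.
by move: Vf; rewrite /bump /=; lra.
Qed.

(** * The relaxed value function as a Lyapunov function *)

Lemma V_deltaxx (R : realType) (n : nat) (P : 'M[R]_n) (x : 'cV[R]_n) :
  V_delta P x x = 0.
Proof. by rewrite /V_delta /wnorm subrr mulmx0 mxE sqrtr0 expr0n. Qed.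

Lemma J_cost_ge_stage_cost (R : realType) (n m N : nat) (D : mpc_data R n m)
    (y : 'cV[R]_n) (u : N.-tuple 'cV[R]_m) :
  (0 < N)%N -> well_posed D -> admissible D y u ->
  stage_cost D y u`_0 <= J_cost D y u.
Proof.
case: N u => // N u _ wD [inU _ _].
rewrite /J_cost big_ord_recl /= traj0 -addrA lerDl addr_ge0 //.
  apply: sumr_ge0 => i _; apply: (stage_cost_ge0 wD).
  exact: (inU _ (ltn_ord (lift ord0 i))).
exact: term_cost_ge0.
Qed.

(** The true and the nominal state move under the same input, so incremental
    stability keeps the penalty from growing while the shifted inputs lower
    the nominal cost. *)
Lemma slack_value_decrease (R : realType) (n m N : nat) (D : mpc_data R n m)
    (P : 'M[R]_n) (k_f : 'cV[R]_n -> 'cV[R]_m) (lambda : R)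
    (x y : 'cV[R]_n) (u : N.-tuple 'cV[R]_m) :
  (0 < N)%N -> terminal_feedback D k_f -> incr_stable D P -> 0 <= lambda ->
  admissible D y u ->
  exists v : N.-tuple 'cV[R]_m, admissible D (dyn D y u`_0) v /\
    slack_objective D P lambda (dyn D x u`_0) (dyn D y u`_0) v <=
    slack_objective D P lambda x y u - stage_cost D y u`_0.
Proof.
move=> N0 law [_ stab] l0 yu; have [inU _ _] := yu.
have [v [vA vJ]] := shifted_inputs N0 law yu.
exists v; split=> //; rewrite /slack_objective.
have := ler_wpM2l l0 (stab x y _ (inU 0 N0)).
by move: vJ; lra.
Qed.

(** This is where lambda has to be large.  A decrease measured at the
    nominal state y says nothing about x if y can be much smaller than x;
    but the penalty is at most c |x|^2, so for large lambda the distance of x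
    and y is at most half the norm of x. *)
Lemma slack_minimizer_state_ge (R : realType) (n m N : nat)
    (D : mpc_data R n m) (P : 'M[R]_n) (kappa lambda c : R)
    (x y : 'cV[R]_n) (u : N.-tuple 'cV[R]_m) :
  (0 < N)%N -> well_posed D -> admissible D y u ->
  0 < kappa -> 0 < c ->
  (forall z : 'cV[R]_n, enorm z ^+ 2 <= kappa * wnorm P z ^+ 2) ->
  4 * kappa * c < lambda ->
  slack_objective D P lambda x y u <= c * enorm x ^+ 2 ->
  enorm x ^+ 2 <= 4 * enorm y ^+ 2.
Proof.
move=> N0 wD yu k0 c0 kP lk; rewrite /slack_objective /V_delta => xle.
have [inU _ _] := yu.
have J0 : 0 <= J_cost D y u.
  apply: le_trans (J_cost_ge_stage_cost N0 wD yu).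
  by apply: (stage_cost_ge0 wD); exact: inU.
have l0 : 0 < lambda by apply: le_lt_trans lk; rewrite !mulr_ge0 // ltW.
suff near_x : 4 * enorm (x - y) ^+ 2 <= enorm x ^+ 2.
  by have := enorm_sqrD_le x y; lra.
rewrite -(ler_pM2l l0); set d := wnorm P _ ^+ 2 in xle *.
have := kP (x - y); rewrite -/d => dk.
apply: (@le_trans _ _ (4 * kappa * (lambda * d))).
  by have := ler_wpM2l (ltW l0) dk; lra.
apply: (@le_trans _ _ (4 * kappa * (c * enorm x ^+ 2))).
  by apply: ler_wpM2l; [rewrite mulr_ge0 // ltW | lra].
by rewrite mulrA ler_wpM2r ?sqr_ge0 // ltW.
Qed.

(** Near the origin the choice y = x is feasible and costs at most the
    terminal cost; away from it the norm of x is at least some eps and Vbar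
    itself is at most (Vbar / eps^2) |x|^2.  The constant is the same for all
    weights lambda, which is what allows lambda to be chosen after it. *)
Lemma slack_value_quadratic (R : realType) (n m N : nat)
    (D : mpc_data R n m) (P : 'M[R]_n) (k_f : 'cV[R]_n -> 'cV[R]_m)
    (c_f Vbar : R) :
  0 < c_f -> 0 < Vbar -> terminal_feedback D k_f ->
  (forall x, term_set D x -> term_cost D x <= c_f * enorm x ^+ 2) ->
  interior (term_set D) 0 ->
  exists2 c : R, 0 < c & forall (lambda : R) (x y : 'cV[R]_n)
      (u : N.-tuple 'cV[R]_m),
    slack_minimizer D P lambda x y u ->
    slack_objective D P lambda x y u <= Vbar ->
    slack_objective D P lambda x y u <= c * enorm x ^+ 2.
Proof.
move=> cf0 V0 law Vf_le /nbhs0_enorm[eps eps0 ball_sub].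
have Ve : 0 < Vbar / eps ^+ 2 by rewrite divr_gt0 // exprn_gt0.
exists (c_f + Vbar / eps ^+ 2) => [|lambda x y u [_ umin] leV].
  exact: addr_gt0.
have x2 := sqr_ge0 (enorm x); rewrite mulrDl.
have [/ball_sub xf|epsx] := ltP (enorm x) eps.
  have [v [vA vJ]] := terminal_rollout N law xf.
  apply: le_trans (umin _ _ vA) _.
  rewrite /slack_objective V_deltaxx mulr0 addr0.
  apply: le_trans vJ (le_trans (Vf_le _ xf) _).
  by rewrite lerDl mulr_ge0 // ltW.
apply: le_trans leV _; apply: ler_wpDl; first by rewrite mulr_ge0 // ltW.
rewrite mulrAC ler_pdivlMr ?exprn_gt0 // ler_pM2l //.
by rewrite ler_sqr ?nnegrE ?enorm_ge0 // ltW.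
Qed.

(** The bounds a e^2 <= W <= b e^2 and the decrease by a e^2 make W a
    geometric sequence of ratio 1 - a / b. *)
Lemma exponential_decay (R : realType) (a b : R) (W e : nat -> R) :
  0 < a -> a < b -> (forall k, 0 <= e k) ->
  (forall k, a * e k ^+ 2 <= W k) -> (forall k, W k <= b * e k ^+ 2) ->
  (forall k, W k.+1 <= W k - a * e k ^+ 2) ->
  forall k, e k <= Num.sqrt (b / a) * Num.sqrt (1 - a / b) ^+ k * e 0%N.
Proof.
move=> a0 ab e0 We Wle Wdec k; have b0 := lt_trans a0 ab.
set r := 1 - a / b.
have r0 : 0 <= r by rewrite subr_ge0 ler_pdivrMr // mul1r ltW.
have contr j : W j.+1 <= r * W j.
  apply: le_trans (Wdec j) _; rewrite /r mulrBl mul1r lerB //.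
  rewrite -mulrA (ler_wpM2l (ltW a0)) // [b^-1 * _]mulrC.
  by rewrite ler_pdivrMr // [_ * b]mulrC.
have Wk j : W j <= r ^+ j * W 0%N.
  elim: j => [|j IH]; first by rewrite mul1r.
  by rewrite exprS -mulrA; apply: le_trans (contr j) _; exact: ler_wpM2l.
rewrite -ler_sqr ?nnegrE ?mulr_ge0 ?exprn_ge0 ?sqrtr_ge0 //.
rewrite !exprMn exprAC !sqr_sqrtr //; last by rewrite divr_ge0 // ltW.
rewrite -(ler_pM2l a0); apply: le_trans (We k) (le_trans (Wk k) _).
apply: (@le_trans _ _ (r ^+ k * (b * e 0%N ^+ 2))).
  by rewrite ler_wpM2l // exprn_ge0.
rewrite le_eqVlt; apply/orP; left; apply/eqP; field.
by rewrite gt_eqF.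
Qed.

(** The infimum over an empty set is infinite, so a state of X_ROA has an
    admissible pair, hence a minimizer. *)
Lemma slack_selection_X_ROA (R : realType) (n m N : nat) (D : mpc_data R n m)
    (alpha_l : R -> R) (P : 'M[R]_n) (lambda Vbar : R)
    (s : 'cV[R]_n -> 'cV[R]_n * N.-tuple 'cV[R]_m) (x : 'cV[R]_n) :
  well_posed D -> regular D alpha_l -> compact (feasible_set D N) ->
  posdef P -> slack_selection D P lambda s -> X_ROA D N P lambda Vbar x ->
  slack_minimizer D P lambda x (s x).1 (s x).2 /\
  slack_objective D P lambda x (s x).1 (s x).2 <= Vbar.
Proof.
move=> wD rD cX posP sel; rewrite /X_ROA /= /V_slack => xV.
have [[y v] yv] : exists p : 'cV[R]_n * N.-tuple 'cV[R]_m,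
    admissible D p.1 p.2.
  apply: contrapT => none; move: xV; rewrite (_ : [set _ | _ in _] = set0).
    by rewrite ereal_inf0 leye_eq.
  by apply/seteqP; split => [z [p pA _]|//]; apply: none; exists p.
have smin := sel x (slack_minimizer_exists lambda x wD rD cX posP yv).
split=> //; rewrite -lee_fin; apply: le_trans xV.
apply: le_ereal_inf_tmp => _ [[z w] zw <-].
by rewrite lee_fin; exact: smin.2.
Qed.

Theorem theorem5 (R : realType) (n m N : nat) (hN : (1 <= N)%N)
    (D : mpc_data R n m) (hD : well_posed D)
    (alpha_l alpha_f : R -> R) (P : 'M[R]_n)
    (hR : regular D alpha_l)
    (hT : terminal D N alpha_f)
    (hE : quadratic alpha_l /\ quadratic alpha_f)
    (hLS : incr_stable D P) :
  forall Vbar : R, 0 < Vbar ->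
  exists lambda_Vbar : R, 0 < lambda_Vbar /\
  forall lambda : R, lambda_Vbar < lambda ->
  forall s : 'cV[R]_n -> 'cV[R]_n * N.-tuple 'cV[R]_m,
    slack_selection D P lambda s ->
    exp_stable D (pi_slack s) (fun _ : nat => 0) (X_ROA D N P lambda Vbar).
Proof.
move=> Vbar V0; have posP := hLS.1; have cX := terminal_compact hT.
have [cl cl0 alphaE] := quadratic_Kinf (regular_Kinf hR) hE.1.
have [cf cf0 alphafE] := quadratic_Kinf (terminal_Kinf hT) hE.2.
have [kf law] := terminal_law hT.
have feedback : terminal_feedback D kf by move=> z /law[? []].
have Vf_le z : term_set D z -> term_cost D z <= cf * enorm z ^+ 2.
  by move=> /law[_ _ _]; rewrite alphafE ?enorm_ge0.
have [kappa kappa0 kappaP] := enorm_sqr_le_wnorm posP.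
(* Neither kappa nor c depends on lambda, so the threshold may use both. *)
have [c c0 Wquad] :=
  slack_value_quadratic N P cf0 V0 feedback Vf_le (terminal_set0 hT).
exists (4 * kappa * c); split; first by rewrite !mulr_gt0.
move=> lambda lambda_gt s sel.
have lambda0 : 0 <= lambda.
  by apply: le_trans (ltW lambda_gt); rewrite !mulr_ge0 // ltW.
pose W x := slack_objective D P lambda x (s x).1 (s x).2.
pose good x := slack_minimizer D P lambda x (s x).1 (s x).2 /\ W x <= Vbar.
have W_le x : good x -> W x <= c * enorm x ^+ 2 by case=> /Wquad.
have stage_ge x : good x ->
    cl / 4 * enorm x ^+ 2 <= stage_cost D (s x).1 (pi_slack s x).
  move=> gx; have [sA _] := gx.1; have [inU _ _] := sA.
  apply: le_trans (regular_lower hR _ (inU 0 hN)).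
  rewrite alphaE ?addr_ge0 ?enorm_ge0 //.
  have := slack_minimizer_state_ge hN hD sA kappa0 c0 kappaP lambda_gt
    (W_le x gx).
  move=> xy; apply: (@le_trans _ _ (cl * enorm (s x).1 ^+ 2)).
    by rewrite -mulrA ler_wpM2l ?(ltW cl0) //; lra.
  rewrite ler_wpM2l ?(ltW cl0) // ler_sqr ?nnegrE ?addr_ge0 ?enorm_ge0 //.
  by rewrite lerDl enorm_ge0.
have W_ge x : good x -> cl / 4 * enorm x ^+ 2 <= W x.
  move=> gx; apply: le_trans (stage_ge x gx) _; have [sA _] := gx.1.
  apply: le_trans (J_cost_ge_stage_cost hN hD sA) _.
  by rewrite lerDl mulr_ge0 // sqr_ge0.
have step x : good x ->
    good (dyn D x (pi_slack s x)) /\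
    W (dyn D x (pi_slack s x)) <= W x - cl / 4 * enorm x ^+ 2.
  move=> gx; have [sA _] := gx.1.
  have [v [vA vW]] := slack_value_decrease x hN feedback hLS lambda0 sA.
  have nmin := sel _ (slack_minimizer_exists lambda (dyn D x (pi_slack s x))
    hD hR cX posP vA).
  have Wdec : W (dyn D x (pi_slack s x)) <= W x - cl / 4 * enorm x ^+ 2.
    apply: le_trans (nmin.2 _ _ vA) (le_trans vW _).
    by rewrite lerD2l lerN2; exact: stage_ge.
  split=> //; split=> //; apply: le_trans Wdec (le_trans _ gx.2).
  by rewrite gerBl mulr_ge0 ?sqr_ge0 // divr_ge0 // ltW.
have a0 : 0 < cl / 4 by rewrite divr_gt0.
(* Adding cl makes the ratio 1 - a / b strictly positive. *)
pose b := c + cl.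
have ab : cl / 4 < b by rewrite /b; lra.
have b0 : 0 < b := lt_trans a0 ab.
exists (Num.sqrt (b / (cl / 4))), (Num.sqrt (1 - cl / 4 / b)); split.
- by rewrite sqrtr_gt0 divr_gt0.
- by rewrite sqrtr_gt0 subr_gt0 ltr_pdivrMr // mul1r.
- rewrite -[ltRHS]sqrtr1 ltr_sqrt // gtrBl.
  by rewrite divr_gt0.
move=> x0 x x0S [x0E xS].
have good_x k : good (x k).
  elim: k => [|k IH].
    by rewrite x0E; exact: (slack_selection_X_ROA hD hR cX posP sel x0S).
  by rewrite xS addr0; exact: (step _ IH).1.
move=> k; rewrite -x0E.
apply: (@exponential_decay _ _ _ (W \o x) (fun k => enorm (x k))) => // j /=.
- exact: enorm_ge0.
- exact: W_ge.
- apply: le_trans (W_le _ (good_x j)) _.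
  by rewrite ler_wpM2r ?sqr_ge0 // /b lerDl ltW.
- by rewrite xS addr0; exact: (step _ (good_x j)).2.
Qed.
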